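(* Let $(M^{n},g,T)$ be a compact connected Riemannian spin manifold ($n\geq3$, $T$ a non-trivial 3-form) with $\nabla^{c}T=0$, and let $\varphi\in\Gamma(\Sigma)$ be a spinor field such that $\nabla^{c}\varphi=0$, where $\nabla^{c}=\nabla^{g}+\frac12T$. Let $\gamma\in\mathbb{R}\setminus\{0\}$. Then the following conditions are equivalent: (a) $\varphi\in\Gamma(\Sigma_{\gamma})\cap\ker(P^{s})$ for some (and thus any) $s\in\mathbb{R}\setminus\{1/4\}$; (b) $\varphi\in\mathcal{K}^{s}(M,g)_{\zeta}$ with $\zeta=\frac{3(1-4s)\gamma}{4n}$, for some (and thus any) $s\in\mathbb{R}\setminus\{0,1/4\}$; (c) $\varphi\in\mathcal{K}(M,g)_{\kappa}$ with $\kappa=\frac{3\gamma}{4n}$.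
   Context: $\nabla^{g}$ is the Levi-Civita connection; $\nabla^{s}$ is the metric connection $g(\nabla^{s}_{X}Y,Z)=g(\nabla^{g}_{X}Y,Z)+2s\,T(X,Y,Z)$, $\nabla^{c}=\nabla^{1/4}$. $\Sigma$ is the spinor bundle, ''$\cdot$'' is Clifford multiplication with $X\cdot Y+Y\cdot X=-2g(X,Y)$; forms act by Clifford multiplication. On $\Sigma$: $\nabla^{s}_{X}\varphi=\nabla^{g}_{X}\varphi+s(X\lrcorner T)\cdot\varphi$, $D^{s}(\varphi)=\sum_{i}e_{i}\cdot\nabla^{s}_{e_{i}}\varphi$. $\varphi\in\ker(P^{s})$ means $\nabla^{s}_{X}\varphi+\frac1nX\cdot D^{s}(\varphi)=0$ for all $X$. $\varphi\in\Gamma(\Sigma_{\gamma})$ means $T\cdot\varphi=\gamma\varphi$. $\mathcal{K}^{s}(M,g)_{\zeta}=\{\varphi\in\Gamma(\Sigma):\nabla^{s}_{X}\varphi=\zeta X\cdot\varphi\ \forall X\}$ and $\mathcal{K}(M,g)_{\kappa}=\{\varphi\in\Gamma(\Sigma):\nabla^{g}_{X}\varphi=\kappa X\cdot\varphi\ \forall X\}$. *)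

(* Defs.v *)
From HB Require Import structures.
From mathcomp Require Import all_boot all_order all_algebra.
From mathcomp Require Import all_classical all_reals all_analysis.
From mathcomp Require Import complex.

Set Implicit Arguments.
Unset Strict Implicit.
Unset Printing Implicit Defensive.

Import Order.TTheory GRing.Theory Num.Theory.
Import numFieldNormedType.Exports.

Local Open Scope classical_set_scope.
Local Open Scope ring_scope.

(* C^k and C^oo on an open set U; for functions between finite-dimensional
   spaces, C^(k+1) means: differentiable with C^k directional derivatives. *)
Fixpoint Ck (R : realType) (V W : normedModType R) (k : nat) (U : set V)
    (f : V -> W) : Prop :=
  if k is k'.+1 then
    (forall x, U x -> differentiable f x) /\
    (forall v : V, Ck k' U (fun x => 'D_v f x))
  else forall x, U x -> {for x, continuous f}.

Definition Cinfty (R : realType) (V W : normedModType R) (U : set V)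
    (f : V -> W) : Prop := forall k, Ck k U f.

(* Charts are total maps that are meaningful on [dom a] only (and [cinv a] on
   the image of [dom a]).  [chart_at p] is a chosen chart around p; besides
   expressing that the charts cover M, it is used below to give tangent vectors
   at p a concrete representation. *)
Record manifold (R : realType) (n : nat) := Manifold {
  points :> topologicalType;
  chart_idx : Type;
  dom : chart_idx -> set points;
  cmap : chart_idx -> points -> 'rV[R]_n;
  cinv : chart_idx -> 'rV[R]_n -> points;
  chart_at : points -> chart_idx;
  points_hausdorff : hausdorff_space points;
  points_second_countable : @second_countable points;
  chart_atP : forall p, dom (chart_at p) p;
  dom_open : forall a, open (dom a);
  img_open : forall a, open (cmap a @` dom a);
  cmapK : forall a p, dom a p -> cinv a (cmap a p) = p;
  cmap_cont : forall a p, dom a p -> {for p, continuous (cmap a)};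
  cinv_cont : forall a x, (cmap a @` dom a) x -> {for x, continuous (cinv a)};
  transition_smooth : forall a b,
    Cinfty (cmap a @` (dom a `&` dom b)) (cmap b \o cinv a)
}.

Section Manifolds.
Variables (R : realType) (n : nat) (M : manifold R n).

Definition smooth_on (U : set M) (f : M -> R) : Prop :=
  forall a, Cinfty (cmap a @` (dom a `&` U)) (f \o cinv a).

Definition csmooth_on (U : set M) (f : M -> R[i]) : Prop :=
  smooth_on U (fun p => complex.Re (f p)) /\
  smooth_on U (fun p => complex.Im (f p)).

(* A tangent vector at p is given by its components in the chart
   [chart_at p]. *)
Definition tangent (p : M) : lmodType R := 'rV[R]_n.

(* The derivative v(f) of f along v in T_p M. *)
Definition tder (p : M) (v : tangent p) (f : M -> R) : R :=
  'D_v (f \o cinv (chart_at p)) (cmap (chart_at p) p).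

Definition vfield : Type := forall p : M, tangent p.

(* X is smooth on the open set U iff its components X(x^j) with respect to
   every chart x of the atlas are. *)
Definition smooth_vfield (U : set M) (X : vfield) : Prop :=
  forall a (j : 'I_n),
    smooth_on (U `&` dom a) (fun p => tder (X p) (fun q => cmap a q ord0 j)).

Record metric := Metric {
  met :> forall p : M, tangent p -> tangent p -> R;
  met_linear : forall p (c : R) (u v w : tangent p),
    met (c *: u + v) w = c * met u w + met v w;
  met_sym : forall p (u v : tangent p), met u v = met v u;
  met_pos : forall p (v : tangent p), v != 0 -> 0 < met v v;
  met_smooth : forall U (X Y : vfield), open U ->
    smooth_vfield U X -> smooth_vfield U Y ->
    smooth_on U (fun p => met (X p) (Y p))
}.

Record threeForm := ThreeForm {
  tform :> forall p : M, tangent p -> tangent p -> tangent p -> R;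
  tform_linear : forall p (c : R) (u u' v w : tangent p),
    tform (c *: u + u') v w = c * tform u v w + tform u' v w;
  tform_alt12 : forall p (u v w : tangent p), tform v u w = - tform u v w;
  tform_alt23 : forall p (u v w : tangent p), tform u w v = - tform u v w;
  tform_smooth : forall U (X Y Z : vfield), open U ->
    smooth_vfield U X -> smooth_vfield U Y -> smooth_vfield U Z ->
    smooth_on U (fun p => tform (X p) (Y p) (Z p))
}.

Definition nontrivial_form (T : threeForm) : Prop :=
  exists p (u v w : tangent p), T p u v w <> 0.

(* nabla p v Y stands for (nabla_v Y)(p), where v in T_p M; it is meaningful
   only for vector fields Y that are smooth near p. *)
Definition covder : Type := forall p : M, tangent p -> vfield -> tangent p.

Record connection (nabla : covder) : Prop := Connection {
  conn_linear : forall U p (c : R) (v w : tangent p) (Y : vfield),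
    open U -> U p -> smooth_vfield U Y ->
    nabla p (c *: v + w) Y = c *: nabla p v Y + nabla p w Y;
  conn_add : forall U p (v : tangent p) (Y Z : vfield),
    open U -> U p -> smooth_vfield U Y -> smooth_vfield U Z ->
    nabla p v (fun q => Y q + Z q) = nabla p v Y + nabla p v Z;
  conn_leibniz : forall U p (v : tangent p) (f : M -> R) (Y : vfield),
    open U -> U p -> smooth_on U f -> smooth_vfield U Y ->
    nabla p v (fun q => f q *: Y q) = tder v f *: Y p + f p *: nabla p v Y;
  conn_smooth : forall U (X Y : vfield),
    open U -> smooth_vfield U X -> smooth_vfield U Y ->
    smooth_vfield U (fun p => nabla p (X p) Y)
}.

(* The torsion condition nabla_X Y - nabla_Y X = [X, Y] is stated as an equality
   of derivations, with [X, Y] f = X (Y f) - Y (X f). *)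
Record levi_civita (g : metric) (nabla : covder) : Prop := LeviCivita {
  lc_connection : connection nabla;
  lc_metric : forall U p (v : tangent p) (Y Z : vfield),
    open U -> U p -> smooth_vfield U Y -> smooth_vfield U Z ->
    tder v (fun q => g q (Y q) (Z q)) =
      g p (nabla p v Y) (Z p) + g p (Y p) (nabla p v Z);
  lc_torsion_free : forall U p (X Y : vfield) (f : M -> R),
    open U -> U p -> smooth_vfield U X -> smooth_vfield U Y -> smooth_on U f ->
    tder (nabla p (X p) Y - nabla p (Y p) X) f =
      tder (X p) (fun q => tder (Y q) f) - tder (Y p) (fun q => tder (X q) f)
}.

Definition skew_torsion_connection (g : metric) (nablag : covder)
    (T : threeForm) (s : R) (nablas : covder) : Prop :=
  forall U p (v z : tangent p) (Y : vfield),
    open U -> U p -> smooth_vfield U Y ->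
    g p (nablas p v Y) z = g p (nablag p v Y) z + 2 * s * T p v (Y p) z.

Definition parallel_form (nabla : covder) (T : threeForm) : Prop :=
  forall U p (v : tangent p) (X Y Z : vfield),
    open U -> U p ->
    smooth_vfield U X -> smooth_vfield U Y -> smooth_vfield U Z ->
    tder v (fun q => T q (X q) (Y q) (Z q)) =
      T p (nabla p v X) (Y p) (Z p) + T p (X p) (nabla p v Y) (Z p)
      + T p (X p) (Y p) (nabla p v Z).

End Manifolds.

(* The spinor module: a complex representation of the Clifford algebra of the
   Euclidean space R^n of dimension 2^(floor(n/2)).  Such a representation is
   irreducible, hence unique up to isomorphism for even n, and one of the two
   irreducible ones (equivalent as representations of Spin(n)) for odd n. *)
Record cliffordModule (R : realType) (n : nat) := CliffordModule {
  gam :> 'I_n -> 'M[R[i]]_(2 ^ n./2);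
  gam_rel : forall i j,
    gam i *m gam j + gam j *m gam i = (- (2 *+ (i == j)))%:M
}.

Section Spin.
Variables (R : realType) (n : nat) (c : cliffordModule R n).

Definition cliff (x : 'rV[R]_n) : 'M[R[i]]_(2 ^ n./2) :=
  \sum_i ((x ord0 i)%:C)%C *: c i.

(* Spin(n): products of an even number of unit vectors.  The spinor module is
   faithful on the even part of the Clifford algebra, so Spin(n) can be
   identified with its image in the matrices. *)
Definition spin_group : set 'M[R[i]]_(2 ^ n./2) :=
  [set A | exists s : seq 'rV[R]_n,
     [/\ forall x, x \in s -> \sum_i x ord0 i ^+ 2 = 1,
         ~~ odd (size s) &
         A = \big[mulmx/1%:M]_(x <- s) cliff x]].

Variables (M : manifold R n) (g : metric M).

(* A spin structure, given by a lift to Spin(n) of the transition functions of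
   the bundle of orthonormal frames.  With e^b_j = sum_i g(e^b_j, e^a_i) e^a_i,
   [trans_lift] says that the image of [trans a b p] in SO(n) under the double
   covering A |-> (x |-> A x A^-1) is the change of frames from a to b. *)
Record spinStructure := SpinStructure {
  spin_idx : Type;
  sdom : spin_idx -> set M;
  frame : spin_idx -> 'I_n -> vfield M;
  trans : spin_idx -> spin_idx -> M -> 'M[R[i]]_(2 ^ n./2);
  sdom_open : forall a, open (sdom a);
  sdom_cover : forall p, exists a, sdom a p;
  frame_smooth : forall a i, smooth_vfield (sdom a) (frame a i);
  frame_orthonormal : forall a p i j, sdom a p ->
    g p (frame a i p) (frame a j p) = (i == j)%:R;
  trans_smooth : forall a b k l,
    csmooth_on (sdom a `&` sdom b) (fun p => trans a b p k l);
  trans_spin : forall a b p, sdom a p -> sdom b p -> spin_group (trans a b p);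
  trans_lift : forall a b p j, sdom a p -> sdom b p ->
    trans a b p *m c j =
      cliff (\row_i g p (frame b j p) (frame a i p)) *m trans a b p;
  trans_cocycle : forall a b d p, sdom a p -> sdom b p -> sdom d p ->
    trans a b p *m trans b d p = trans a d p
}.

Variable S : spinStructure.

(* Smooth sections of the spinor bundle associated with S, given by their
   components in the local trivializations. *)
Record spinor := Spinor {
  scomp :> spin_idx S -> M -> 'cV[R[i]]_(2 ^ n./2);
  scomp_smooth : forall a k, csmooth_on (sdom a) (fun p => scomp a p k ord0);
  scomp_glue : forall a b p, sdom a p -> sdom b p ->
    scomp a p = trans a b p *m scomp b p
}.

(* From here on, a denotes a local trivialization with p in [sdom a], psi an
   element of the fibre of the spinor bundle at p, and all values are expressed
   in the trivialization a. *)

Definition cmul (a : spin_idx S) (p : M) (v : tangent p)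
    (psi : 'cV[R[i]]_(2 ^ n./2)) : 'cV[R[i]]_(2 ^ n./2) :=
  cliff (\row_i g p v (frame a i p)) *m psi.

(* Forms act by Clifford multiplication: for an orthonormal frame and
   i < j < k, e_i ^ e_j ^ e_k acts as e_i . e_j . e_k. *)
Definition form_mul (T : threeForm M) (a : spin_idx S) (p : M)
    (psi : 'cV[R[i]]_(2 ^ n./2)) : 'cV[R[i]]_(2 ^ n./2) :=
  \sum_(i < n) \sum_(j < n | (i < j)%N) \sum_(k < n | (j < k)%N)
    ((T p (frame a i p) (frame a j p) (frame a k p))%:C)%C *:
      (c i *m c j *m c k *m psi).

Definition contraction_mul (T : threeForm M) (a : spin_idx S) (p : M)
    (v : tangent p) (psi : 'cV[R[i]]_(2 ^ n./2)) : 'cV[R[i]]_(2 ^ n./2) :=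
  \sum_(i < n) \sum_(j < n | (i < j)%N)
    ((T p v (frame a i p) (frame a j p))%:C)%C *: (c i *m c j *m psi).

Variable nablag : covder M.
Arguments nablag : clear implicits.

(* The spinorial Levi-Civita connection:
   v(phi) + 1/2 sum_(i < j) g(nabla_v e_i, e_j) e_i . e_j . phi. *)
Definition spin_nablag (phi : spinor) (a : spin_idx S) (p : M)
    (v : tangent p) : 'cV[R[i]]_(2 ^ n./2) :=
  \col_k (tder v (fun q => complex.Re (phi a q k ord0)) +i*
          tder v (fun q => complex.Im (phi a q k ord0)))%C
  + \sum_(i < n) \sum_(j < n | (i < j)%N)
      ((2^-1 * g p (nablag p v (frame a i)) (frame a j p))%:C)%C *:
        (c i *m c j *m phi a p).

Variable T : threeForm M.

Definition spin_nabla (s : R) (phi : spinor) (a : spin_idx S) (p : M)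
    (v : tangent p) : 'cV[R[i]]_(2 ^ n./2) :=
  spin_nablag phi a v + (s%:C)%C *: contraction_mul T a v (phi a p).

Definition dirac (s : R) (phi : spinor) (a : spin_idx S) (p : M) :
    'cV[R[i]]_(2 ^ n./2) :=
  \sum_i cmul a (frame a i p) (spin_nabla s phi a (frame a i p)).

Definition spin_parallel (s : R) (phi : spinor) : Prop :=
  forall a p (v : tangent p), sdom a p -> spin_nabla s phi a v = 0.

Definition twistor_kernel (s : R) (phi : spinor) : Prop :=
  forall a p (v : tangent p), sdom a p ->
    spin_nabla s phi a v + ((n%:R^-1)%:C)%C *: cmul a v (dirac s phi a p) = 0.

Definition in_Sigma (gamma : R) (phi : spinor) : Prop :=
  forall a p, sdom a p -> form_mul T a p (phi a p) = (gamma%:C)%C *: phi a p.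

Definition killing_torsion (s zeta : R) (phi : spinor) : Prop :=
  forall a p (v : tangent p), sdom a p ->
    spin_nabla s phi a v = (zeta%:C)%C *: cmul a v (phi a p).

Definition killing (kappa : R) (phi : spinor) : Prop :=
  forall a p (v : tangent p), sdom a p ->
    spin_nablag phi a v = (kappa%:C)%C *: cmul a v (phi a p).

End Spin.

(* Main.v *)
Require Import Defs.
From HB Require Import structures.
From mathcomp Require Import all_boot all_order all_algebra.
From mathcomp Require Import all_classical all_reals all_analysis.
From mathcomp Require Import complex.
From mathcomp Require Import ring.

(** Every condition of the theorem is pointwise once the derivative of the
    spinor is eliminated.  A spinor with [nabla^(1/4) phi = 0] satisfies
    [nabla^s_X phi = (s - 1/4) (X _| T) . phi] for every [s]
    ([spin_nabla_of_parallel]).  The Killing conditions, with or without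
    torsion, thus all say, after division by the nonzero scalar [s - 1/4],
    that

      [(X _| T) . phi = - (3 gamma / n) X . phi]   for all [X],

    an equation that does not mention [s] ([contraction_killing]); the constants
    [zeta] and [kappa] are exactly those for which this happens.

    The twistor condition contains the Dirac operator, and there the identity
    [sum_i e_i . (e_i _| T) . psi = 3 T . psi] ([frame_contraction_sum]) gives
    [D^s phi = 3 (s - 1/4) T . phi].  If [T . phi = gamma phi], the twistor
    equation becomes the same algebraic equation.  Conversely, multiplying the
    algebraic equation by [e_i] and summing over [i], the left-hand side is
    [3 T . phi] and, since [sum_i e_i . e_i = - n], the right-hand side is
    [3 gamma phi]; so the eigenvalue equation [T . phi = gamma phi] comes for
    free.

    As the algebraic equation is independent of [s], a condition that holds for
    one admissible [s] holds for all of them. *)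

Set Implicit Arguments.
Unset Strict Implicit.
Unset Printing Implicit Defensive.

Import Order.TTheory GRing.Theory Num.Theory.
Import numFieldNormedType.Exports.

Local Open Scope classical_set_scope.
Local Open Scope ring_scope.

(** A symmetric function that vanishes on the diagonals sees each triple
    [i < j < k] three times in the left-hand side, according to whether the
    distinguished index [l] is the smallest, the middle or the largest one. *)
Lemma sum_symmetric_triples (V : zmodType) (n : nat)
    (f : 'I_n -> 'I_n -> 'I_n -> V) :
  (forall i j k, f j i k = f i j k) -> (forall i j k, f i k j = f i j k) ->
  (forall i k, f i i k = 0) ->
  \sum_(l < n) \sum_(i < n) \sum_(j < n | (i < j)%N) f l i j =
  (\sum_(i < n) \sum_(j < n | (i < j)%N) \sum_(k < n | (j < k)%N) f i j k) *+ 3.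
Proof.
move=> f12 f23 f0.
have fjj i j : f i j j = 0 by rewrite -f12 -f23 f0.
have position (i j : 'I_n) : (i < j)%N -> \sum_l f l i j =
    \sum_(l < n | (l < i)%N) f l i j +
    (\sum_(l < n | (i < l < j)%N) f i l j + \sum_(l < n | (j < l)%N) f i j l).
  move=> ij; rewrite (big_mkcond (fun l : 'I_n => (l < i)%N)) /=.
  rewrite (big_mkcond (fun l : 'I_n => (i < l < j)%N)) /=.
  rewrite (big_mkcond (fun l : 'I_n => (j < l)%N)) /= -!big_split /=.
  apply: eq_bigr => l _.
  case: (ltngtP l i) => [li|il|/val_inj ->] /=.
  - by rewrite [(j < l)%N]ltnNge (ltnW (ltn_trans li ij)) !addr0.
  - rewrite add0r; case: (ltngtP l j) => [lj|jl|/val_inj ->] /=.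
    + by rewrite addr0 f12.
    + by rewrite add0r -f12 -f23.
    + by rewrite addr0 f12 fjj.
  - by rewrite ltnNge (ltnW ij) f0 !addr0.
rewrite exchange_big /=.
under eq_bigr => i _ do rewrite exchange_big /=.
under eq_bigr => i _ do
  (under eq_bigr => j ij do rewrite position //; rewrite !big_split /=).
rewrite !big_split /= mulrS mulr2n; congr (_ + (_ + _)).
- under eq_bigr => i _ do rewrite exchange_big /=.
  by rewrite (exchange_big_dep xpredT).
- apply: eq_bigr => i _; rewrite (exchange_big_dep (fun l : 'I_n => (i < l)%N)).
    apply: eq_bigr => l il; apply: eq_bigl => j; rewrite il /=.
    by case: (ltnP l j) => lj; rewrite ?andbF ?andbT // (ltn_trans il lj).
  by move=> j l _ /andP[].
Qed.

Section CliffordFrame.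
Variables (R : realType) (n : nat) (c : cliffordModule R n).
Variables (M : manifold R n) (g : metric M) (S : spinStructure c g).
Variables (T : threeForm M).
Local Notation spin_fibre := 'cV[R[i]]_(2 ^ n./2).

Lemma gam_anticomm (i j : 'I_n) : i != j -> c j *m c i = - (c i *m c j).
Proof.
move=> ij; apply/eqP; rewrite -addr_eq0 gam_rel [j == i]eq_sym (negPf ij).
by rewrite oppr0 raddf0.
Qed.

Lemma gam_sqr (i : 'I_n) : c i *m c i = - 1%:M.
Proof.
have := gam_rel c i i; rewrite eqxx mulr1n => h.
have two0 : (2 : R[i]) != 0 by rewrite pnatr_eq0.
apply: (scalerI two0); rewrite scaler_nat mulr2n h scalerN scale_scalar_mx.
by rewrite mulr1 raddfN.
Qed.

Lemma cmul_frame (a : spin_idx S) (p : M) (i : 'I_n) (psi : spin_fibre) :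
  sdom a p -> cmul a (frame a i p) psi = c i *m psi.
Proof.
move=> ap; rewrite /cmul /cliff (bigD1 i) //= big1 => [|j ji].
  by rewrite mxE frame_orthonormal // eqxx scale1r addr0.
by rewrite mxE frame_orthonormal // eq_sym (negPf ji) scale0r.
Qed.

Lemma cmulZ (a : spin_idx S) (p : M) (v : tangent p) (z : R[i])
    (psi : spin_fibre) : cmul a v (z *: psi) = z *: cmul a v psi.
Proof. by rewrite /cmul scalemxAr. Qed.

Lemma frame_cmul_sum (a : spin_idx S) (p : M) (psi : spin_fibre) :
  sdom a p ->
  \sum_i cmul a (frame a i p) (cmul a (frame a i p) psi) = - n%:R *: psi.
Proof.
move=> ap.
under eq_bigr => i _ do rewrite !cmul_frame // mulmxA gam_sqr mulNmx mul1mx.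
by rewrite sumr_const card_ord scaleNr scaler_nat mulNrn.
Qed.

Lemma tform_diag (p : M) (u w : tangent p) : T p u u w = 0.
Proof.
by apply/eqP; rewrite -[_ == 0](mulrn_eq0 _ 2) mulr2n {1}tform_alt12 addNr.
Qed.

(** Exchanging two indices changes the sign of the component of [T] and that of
    the product of Clifford generators, so that the summand is a symmetric
    function of the three indices. *)
Lemma frame_contraction_sum (a : spin_idx S) (p : M) (psi : spin_fibre) :
  sdom a p ->
  \sum_i cmul a (frame a i p) (contraction_mul T a (frame a i p) psi) =
  3 *: form_mul T a p psi.
Proof.
move=> ap; pose e i := frame a i p.
pose f i j k := ((T p (e i) (e j) (e k))%:C)%C *: (c i *m c j *m c k *m psi).
have f0 i k : f i i k = 0 by rewrite /f tform_diag scale0r.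
transitivity (\sum_(l < n) \sum_(i < n) \sum_(j < n | (i < j)%N) f l i j).
  apply: eq_bigr => l _; rewrite cmul_frame // mulmx_sumr.
  apply: eq_bigr => i _; rewrite mulmx_sumr.
  by apply: eq_bigr => j _; rewrite -scalemxAr !mulmxA.
rewrite sum_symmetric_triples ?scaler_nat // => i j k.
- have [->//|ij] := eqVneq i j.
  rewrite /f tform_alt12 (gam_anticomm ij) !mulNmx scalerN.
  by rewrite rmorphN scaleNr opprK.
- have [->//|jk] := eqVneq j k.
  rewrite /f tform_alt23 -[c i *m c k *m c j]mulmxA (gam_anticomm jk).
  by rewrite mulmxN !mulNmx scalerN rmorphN scaleNr opprK mulmxA.
Qed.

Variables (nablag : covder M) (phi : spinor S).

(** The algebraic equation to which each of the three conditions reduces for a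
    spinor that is parallel for the parameter [1/4]. *)
Definition contraction_killing (gamma : R) : Prop :=
  forall a p (v : tangent p), sdom a p ->
    contraction_mul T a v (phi a p) =
    ((- (3 * gamma / n%:R))%:C)%C *: cmul a v (phi a p).

Hypothesis phi_parallel : spin_parallel nablag T 4^-1 phi.

(** The [s]-dependence of [nabla^s] is affine with slope [(X _| T) .], and at
    [s = 1/4] the value is zero. *)
Lemma spin_nabla_of_parallel (s : R) a p (v : tangent p) : sdom a p ->
  spin_nabla nablag T s phi a v =
  ((s - 4^-1)%:C)%C *: contraction_mul T a v (phi a p).
Proof.
move=> ap; have /eqP := phi_parallel v ap.
rewrite /spin_nabla addr_eq0 => /eqP ->.
by rewrite rmorphB scalerBl addrC.
Qed.

Lemma dirac_of_parallel (s : R) a p : sdom a p ->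
  Defs.dirac nablag T s phi a p =
  ((3 * (s - 4^-1))%:C)%C *: form_mul T a p (phi a p).
Proof.
move=> ap; rewrite /Defs.dirac.
under eq_bigr => i _ do rewrite spin_nabla_of_parallel // cmulZ.
rewrite -scaler_sumr frame_contraction_sum // scalerA rmorphM rmorph_nat.
by rewrite mulrC.
Qed.

Lemma scaler_real_inj (x : R) (u w : spin_fibre) :
  x != 0 -> ((x%:C)%C *: u = (x%:C)%C *: w) <-> u = w.
Proof.
move=> x0; split=> [|->//]; apply: scalerI.
by rewrite -(rmorph0 (real_complex R)) (inj_eq (fmorph_inj _)).
Qed.

Lemma killing_torsion_of_parallel (s gamma : R) : s != 4^-1 ->
  killing_torsion nablag T s (3 * (1 - 4 * s) * gamma / (4 * n%:R)) phi <->
  contraction_killing gamma.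
Proof.
rewrite -subr_eq0 => s0.
have -> : 3 * (1 - 4 * s) * gamma / (4 * n%:R) =
          (s - 4^-1) * - (3 * gamma / n%:R).
  by rewrite invfM; move: n%:R^-1 => m; field.
by split=> h a p v ap; have := h a p v ap;
  rewrite spin_nabla_of_parallel // rmorphM -scalerA scaler_real_inj.
Qed.

(** The Levi-Civita connection is the member [s = 0] of the family. *)
Lemma killing_of_parallel (gamma : R) :
  killing nablag (3 * gamma / (4 * n%:R)) phi <-> contraction_killing gamma.
Proof.
have s0 : (0 : R) != 4^-1 by rewrite eq_sym invr_eq0 pnatr_eq0.
rewrite -(killing_torsion_of_parallel _ s0) mulr0 subr0 mulr1.
by split=> h a p v ap; have := h a p v ap; rewrite /spin_nabla scale0r addr0.
Qed.

Hypothesis n_gt0 : (0 < n)%N.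

(** Multiplying the equation by [e_i] and summing turns both sides into
    multiples of [T . phi] and [phi], and the factor [n] coming from
    [sum_i e_i . e_i = - n] cancels the denominator of [3 gamma / n]. *)
Lemma in_Sigma_of_contraction_killing (gamma : R) :
  contraction_killing gamma -> in_Sigma T gamma phi.
Proof.
have n0 : (n%:R : R) != 0 by rewrite pnatr_eq0 -lt0n.
have three0 : (3 : R) != 0 by rewrite pnatr_eq0.
move=> h a p ap; apply/(scaler_real_inj _ _ three0).
rewrite rmorph_nat -frame_contraction_sum //.
under eq_bigr => i _ do rewrite h // cmulZ.
rewrite -scaler_sumr frame_cmul_sum // !scalerA.
rewrite -(rmorph_nat (real_complex R) n).
rewrite -rmorphN -(rmorph_nat (real_complex R) 3) -!rmorphM.
by congr ((_%:C)%C *: _); field.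
Qed.

Lemma twistor_kernel_of_parallel (s gamma : R) : s != 4^-1 ->
  in_Sigma T gamma phi /\ twistor_kernel nablag T s phi <->
  contraction_killing gamma.
Proof.
rewrite -subr_eq0 => s0.
suff twistorE : in_Sigma T gamma phi ->
    twistor_kernel nablag T s phi <-> contraction_killing gamma.
  split=> [[hT]|h]; first by move/(twistorE hT).
  by have hT := in_Sigma_of_contraction_killing h; split=> //; apply/twistorE.
move=> hT.
(* On an eigenspinor of [T] the twistor operator is [s - 1/4] times the defect
   of the algebraic equation. *)
have eqn a p (v : tangent p) : sdom a p ->
    spin_nabla nablag T s phi a v
      + ((n%:R^-1)%:C)%C *: cmul a v (Defs.dirac nablag T s phi a p) =
    ((s - 4^-1)%:C)%C *: (contraction_mul T a v (phi a p)
      - ((- (3 * gamma / n%:R))%:C)%C *: cmul a v (phi a p)).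
  move=> ap; rewrite spin_nabla_of_parallel // dirac_of_parallel // hT //.
  rewrite !cmulZ scalerBr !scalerA -!rmorphM -scaleNr -rmorphN; congr (_ + _).
  by congr ((_%:C)%C *: _); ring.
split=> h a p v ap; last by rewrite eqn // h // subrr scaler0.
apply/eqP; rewrite -subr_eq0; apply/eqP/(scaler_real_inj _ _ s0).
by rewrite -eqn // scaler0 h.
Qed.

End CliffordFrame.

Theorem theorem3p7 (R : realType) (n : nat) (M : manifold R n) (g : metric M)
    (nablag nablac : covder M) (T : threeForm M) (c : cliffordModule R n)
    (S : spinStructure c g) (phi : spinor S) (gamma : R)
    (n_ge3 : (3 <= n)%N)
    (M_compact : compact [set: M])
    (M_connected : connected [set: M])
    (T_nontrivial : nontrivial_form T)
    (nablag_lc : levi_civita g nablag)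
    (nablac_def : skew_torsion_connection g nablag T 4^-1 nablac)
    (T_parallel : parallel_form nablac T)
    (phi_parallel : spin_parallel nablag T 4^-1 phi)
    (gamma_neq0 : gamma <> 0) :
  let a s := in_Sigma T gamma phi /\ twistor_kernel nablag T s phi in
  let b s :=
    killing_torsion nablag T s (3 * (1 - 4 * s) * gamma / (4 * n%:R)) phi in
  let a_some := exists s : R, s <> 4^-1 /\ a s in
  let a_any := forall s : R, s <> 4^-1 -> a s in
  let b_some := exists s : R, [/\ s <> 0, s <> 4^-1 & b s] in
  let b_any := forall s : R, s <> 0 -> s <> 4^-1 -> b s in
  let k := killing nablag (3 * gamma / (4 * n%:R)) phi in
  [/\ a_some <-> a_any, b_some <-> b_any, a_some <-> b_some & b_some <-> k].
Proof.
move=> a b a_some a_any b_some b_any k.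
have n_gt0 : (0 < n)%N by apply: leq_trans n_ge3.
pose K := contraction_killing T phi gamma.
have aK s : s <> 4^-1 -> a s <-> K.
  by move/eqP; exact: twistor_kernel_of_parallel.
have bK s : s <> 4^-1 -> b s <-> K.
  by move/eqP; exact: killing_torsion_of_parallel.
have kK : k <-> K by exact: killing_of_parallel.
(* [0] and [1] serve as admissible parameters for (a) and (b) respectively. *)
have zero_adm : (0 : R) <> 4^-1.
  by apply/eqP; rewrite eq_sym invr_eq0 pnatr_eq0.
have one_adm : (1 : R) <> 4^-1.
  by apply/eqP; rewrite eq_sym invr_eq1 pnatr_eq1.
have one_neq0 : (1 : R) <> 0 by apply/eqP; rewrite oner_eq0.
have a_someK : a_some <-> K.
  by split=> [[s [s4 /(aK _ s4)]] //|h]; exists 0; split=> //; apply/aK.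
have a_anyK : a_any <-> K.
  by split=> [/(_ _ zero_adm)/(aK _ zero_adm)//|h s s4]; apply/aK.
have b_someK : b_some <-> K.
  by split=> [[s [_ s4 /(bK _ s4)]] //|h]; exists 1; split=> //; apply/bK.
have b_anyK : b_any <-> K.
  by split=> [/(_ _ one_neq0 one_adm)/(bK _ one_adm)//|h s _ s4]; apply/bK.
by split; rewrite ?a_someK ?a_anyK ?b_someK ?b_anyK ?kK.
Qed.
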